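(* Suppose assumptions (A1), (A2), (B1), (B2), (B3) of the context hold, and consider the RCDlin algorithm (described in the context) with $K\ge 1$ outer iterations. Suppose further that there are constants $\omega_0,\omega_1>0$ and a positive integer $S_{\max}$ such that, for every epoch $k$ and all $s\le S_{\max}-1$, $$\omega_0\langle\nabla f(X_k^s),B_{\ell_k^s}\rangle^2\;\le\;\theta_k^s\,\langle\nabla f(X_k^s),B_{\ell_k^s}\rangle\;\le\;\omega_1\langle\nabla f(X_k^s),B_{\ell_k^s}\rangle^2 ,$$ where $B_{\ell_k^s}=B_{\ell_k^s,X_k^s}$ and $\theta_k^s=\langle \nabla f(X_k),B_{\ell_k^s}\rangle$. Let $\Delta_0:=f(X_0)-f^*$. (Randomized.) If $1<S\le S_{\max}$, each $\ell_k^s$ is selected uniformly at random from $\mathcal I$, and $\eta=\frac{\omega_0}{Lc_b\omega_1^2}$, then $$\min_{0\le k\le K-1,\;0\le s\le S-1}\mathbb E\,\|\mathrm{grad} f(X_k^s)\|_{X_k^s}^2\le\frac{2L\,c_b^2\,c_p^{-1}\,\omega_0^{-2}\,\omega_1^2\,|\mathcal I|\,\Delta_0}{KS}.$$ (Cyclic.) If $S_{\max}\ge|\mathcal I|$, $S=|\mathcal I|$, $\ell_k^s=s+1$ for $s=0,\dots,|\mathcal I|-1$ (identifying $\mathcal I$ with $\{1,\dots,|\mathcal I|\}$), and $\eta=\frac{\omega_0}{Lc_b\omega_1^2}$, then $$\min_{0\le k\le K-1}\|\mathrm{grad} f(X_k)\|_{X_k}^2\le\frac{\widetilde C\,\Delta_0}{K},\qquad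 \widetilde C=4L\,c_b^2\,\omega_1^2\,\omega_0^{-2}\,c_p^{-1}\,\upsilon^{-1}\bigl(1+|\mathcal I|^2c_b^{-1}L^{-2}L_g\,\vartheta_1\vartheta_0^{-1}\bigr).$$
   Context: Setting. $\mathcal M$ is a Riemannian manifold of matrices embedded in a Euclidean matrix space $\mathbb R^{m\times n}$, with Riemannian metric $\langle\cdot,\cdot\rangle_X$ and norm $\|\cdot\|_X$ on $T_X\mathcal M$, and Riemannian distance $\mathrm{dist}$; $\langle\cdot,\cdot\rangle$ without subscript is the Euclidean (Frobenius) inner product. $f:\mathcal M\to\mathbb R$ is differentiable with Euclidean gradient $\nabla f(X)$, and the Riemannian gradient $\mathrm{grad} f(X)\in T_X\mathcal M$ is defined by $\langle \mathrm{grad} f(X),U\rangle_X=\langle\nabla f(X),U\rangle$ for all $U\in T_X\mathcal M$. A retraction is a map $\mathrm{Retr}_X:T_X\mathcal M\to\mathcal M$ with $\mathrm{Retr}_X(0)=X$ and $\mathrm D\,\mathrm{Retr}_X(0)[U]=U$. $\mathcal I$ is a finite index set, and for each $X$ there are tangent vectors $B_{\ell,X}\in T_X\mathcal M$, $\ell\in\mathcal I$, spanning $T_X\mathcal M$ (called the basis; not necessarily orthonormal or linearly independent). $f^*$ denotes the minimum value of $f$ on $\mathcal M$. RCDlin algorithm. Given $X_0\in\mathcal M$, positive integers $K,S$ and stepsize $\eta>0$: for $k=0,\dots,K-1$ (epochs), set $X_k^0=X_k$; for $s=0,\dots,S-1$ pick an index $\ell_k^s\in\mathcal I$, set $\theta_k^s=\langle\nabla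 f(X_k),B_{\ell_k^s,X_k^s}\rangle$ (the gradient is evaluated at the epoch's anchor $X_k$, the basis vector at $X_k^s$) and $X_k^{s+1}=\mathrm{Retr}_{X_k^s}(-\eta\,\theta_k^s\,B_{\ell_k^s,X_k^s})$; then set $X_{k+1}=X_k^S$. Assumptions. $\mathcal X\subseteq\mathcal M$ is a compact neighbourhood containing a critical point of $f$, and all iterates remain in $\mathcal X$. Write $\mathcal P_{B_{\ell,X}}(U):=\langle U,B_{\ell,X}\rangle_X B_{\ell,X}$. $\mathcal T_X^Y:T_X\mathcal M\to T_Y\mathcal M$ is an isometric vector transport: $\langle\mathcal T_X^YU,\mathcal T_X^YV\rangle_Y=\langle U,V\rangle_X$ for all $X,Y\in\mathcal X$, $U,V\in T_X\mathcal M$. (A1) There are constants $c_b,c_p>0$ such that for all $X\in\mathcal X$, $U\in T_X\mathcal M$, $\ell\in\mathcal I$: $\|B_{\ell,X}\|_X^2\le c_b$ and $\sum_{\ell\in\mathcal I}\|\mathcal P_{B_{\ell,X}}U\|_X^2\ge c_p\|U\|_X^2$. (A2) There is $L>0$ such that $f(\mathrm{Retr}_X(U))-f(X)-\langle\mathrm{grad} f(X),U\rangle_X\le\frac L2\|U\|_X^2$ for all $X\in\mathcal X$ and $U\in T_X\mathcal M$ with $\mathrm{Retr}_X(U)\in\mathcal X$. (B1) There are constants $\vartheta_0,\vartheta_1>0$ such that $\vartheta_0\|U\|_X^2\le\mathrm{dist}^2(X,Y)\le\vartheta_1\|U\|_X^2$ for all $X,\ Y=\mathrm{Retr}_X(U)\in\mathcal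 X$. (B2) There is $L_g>0$ such that $\|\mathrm{grad} f(X)-\mathcal T_Y^X\mathrm{grad} f(Y)\|_X^2\le L_g\|U\|_X^2$ for all $X,\ Y=\mathrm{Retr}_X(U)\in\mathcal X$. (B3) For any fixed index $\ell\in\mathcal I$ there is a constant $\upsilon>0$ such that $\|\mathcal P_{B_{\ell,X}}\mathcal T_Y^XV\|_X^2\ge\upsilon\|\mathcal P_{B_{\ell,Y}}V\|_Y^2$ for all $X,Y\in\mathcal X$, $V\in T_Y\mathcal M$ (with $\upsilon$ taken the same for all $\ell$).
   Formalization: The comparability assumption also requires θ_k^s = 0 whenever ⟨∇f(X_k^s),B_{ℓ_k^s}⟩ = 0 (both parts), and in C̃ the factor c_b^{-1} inside the parenthesis is replaced by max(1, c_b^{-1}); the claims as printed fail without these changes. *)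

(* Defs.v *)
From HB Require Import structures.
From mathcomp Require Import all_boot all_order all_algebra.
From mathcomp Require Import all_classical all_reals all_analysis.

Set Implicit Arguments.
Unset Strict Implicit.
Unset Printing Implicit Defensive.

Import Order.TTheory GRing.Theory Num.Theory.
Import numFieldNormedType.Exports.

Local Open Scope classical_set_scope.
Local Open Scope ring_scope.

Section Geometry.
Variable R : realType.

(* In finite dimension, being of class C^{k+1} on an open set amounts to having
   all directional derivatives, each of class C^k. *)
Fixpoint Ck_on (V W : normedModType R) (k : nat) (O : set V) (f : V -> W) :
    Prop :=
  if k is k'.+1 then
    (forall x v, O x -> derivable f x v) /\
    (forall v, Ck_on k' O (fun x => 'D_v f x))
  else forall x, O x -> {for x, continuous f}.

Definition smooth_on (V W : normedModType R) (O : set V) (f : V -> W) : Prop :=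
  forall k, Ck_on k O f.

Variables m n : nat.
Local Notation E := 'M[R]_(m, n).

Definition frob (U V : E) : R := \tr (U^T *m V).

Definition egrad (f : E -> R) (X : E) : E :=
  \matrix_(i < m, j < n) 'D_(delta_mx i j) f X.

(* For d = m * n the local defining function h takes values in the zero space
   and the condition says that M is open. *)
Definition embedded_submanifold (d : nat) (M : set E) : Prop :=
  [/\ (d <= m * n)%N, M !=set0 &
    forall X, M X -> exists (O : set E) (h : E -> 'rV[R]_(m * n - d)),
      [/\ open O, O X, smooth_on O h,
          M `&` O = [set Y | O Y /\ h Y = 0] &
          forall w, exists v, 'D_v h X = w]].

Definition tangent (M : set E) (X : E) : set E :=
  [set v | exists (O : set R) (c : R -> E),
    [/\ open O, O 0, smooth_on O c, (forall t, O t -> M (c t)) &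
        c 0 = X /\ derive1 c 0 = v]].

Definition smooth_on_submanifold (W : normedModType R) (M : set E)
    (F : E -> W) : Prop :=
  forall X, M X -> exists (O : set E) (G : E -> W),
    [/\ open O, O X, smooth_on O G & forall Y, M Y -> O Y -> G Y = F Y].

Definition inner_product_on (T : set E) (b : E -> E -> R) : Prop :=
  [/\ forall U V, T U -> T V -> b U V = b V U,
      forall (a : R) U V Z, T U -> T V -> T Z ->
        b (a *: U + V) Z = a * b U Z + b V Z &
      forall U, T U -> U != 0 -> 0 < b U U].

Definition riemannian_metric (M : set E) (g : E -> E -> E -> R) : Prop :=
  (forall X, M X -> inner_product_on (tangent M X) (g X)) /\
  (forall V W : E -> E,
     smooth_on_submanifold M V -> (forall X, M X -> tangent M X (V X)) ->
     smooth_on_submanifold M W -> (forall X, M X -> tangent M X (W X)) ->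
     smooth_on_submanifold M (fun X => g X (V X) (W X) : R^o)).

Definition rnorm (g : E -> E -> E -> R) (X U : E) : R := Num.sqrt (g X U U).

Definition is_rgrad (M : set E) (g : E -> E -> E -> R) (f : E -> R)
    (grad : E -> E) : Prop :=
  forall X, M X -> tangent M X (grad X) /\
    forall U, tangent M X U -> g X (grad X) U = frob (egrad f X) U.

Definition piecewise_smooth (c : R -> E) : Prop :=
  exists (N : nat) (t : nat -> R),
    [/\ t 0%N = 0, t N = 1, forall i, (i < N)%N -> t i < t i.+1 &
      forall i, (i < N)%N -> exists (O : set R) (ci : R -> E),
        [/\ open O, `[t i, t i.+1] `<=` O, smooth_on O ci &
            forall u, t i <= u <= t i.+1 -> c u = ci u]].

Definition curve_length (g : E -> E -> E -> R) (c : R -> E) : \bar R :=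
  (\int[@lebesgue_measure R]_(t in `[0%R, 1%R])
     (rnorm g (c t) (derive1 c t))%:E)%E.

(* The value is +oo when X and Y lie in different components of M. *)
Definition rdist (M : set E) (g : E -> E -> E -> R) (X Y : E) : \bar R :=
  ereal_inf [set curve_length g c | c in
    [set c | [/\ piecewise_smooth c, c 0 = X, c 1 = Y &
                 forall t, 0 <= t <= 1 -> M (c t)]]].

Definition retraction (M : set E) (Retr : E -> E -> E) : Prop :=
  forall X, M X ->
    [/\ forall U, tangent M X U -> M (Retr X U),
        Retr X 0 = X &
        forall U, tangent M X U ->
          is_derive (0 : R) 1 (fun t : R => Retr X (t *: U)) U].

(* [Tr X Y] is the transport from the tangent space at X to that at Y. *)
Definition isometric_transport (M calX : set E) (g : E -> E -> E -> R)
    (Tr : E -> E -> E -> E) : Prop :=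
  forall X Y, calX X -> calX Y ->
    [/\ forall U, tangent M X U -> tangent M Y (Tr X Y U),
        forall (a : R) U V, tangent M X U -> tangent M X V ->
          Tr X Y (a *: U + V) = a *: Tr X Y U + Tr X Y V &
        forall U V, tangent M X U -> tangent M X V ->
          g Y (Tr X Y U) (Tr X Y V) = g X U V].

Definition compact_nbhs_of_critical (M calX : set E) (grad : E -> E) : Prop :=
  [/\ compact calX, calX `<=` M &
      exists X, [/\ M X, grad X = 0 & within M (nbhs X) calX]].

Definition minimum_on (M : set E) (f : E -> R) (fstar : R) : Prop :=
  (exists2 X, M X & f X = fstar) /\ forall X, M X -> fstar <= f X.

Section Basis.
Variables (I : finType) (B : I -> E -> E).

Definition spanning_basis (M : set E) : Prop :=
  forall X, M X ->
    tangent M X = [set \sum_(l : I) a l *: B l X | a in [set: I -> R]].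

Definition projB (g : E -> E -> E -> R) (l : I) (X U : E) : E :=
  g X U (B l X) *: B l X.

Section RCDlin.
Variables (f : E -> R) (Retr : E -> E -> E) (eta : R).

Fixpoint rcdlin_inner (anchor : E) (l : nat -> I) (s : nat) : E :=
  if s is s'.+1 then
    let Y := rcdlin_inner anchor l s' in
    Retr Y (- (eta * frob (egrad f anchor) (B (l s') Y)) *: B (l s') Y)
  else anchor.

Variables (S : nat) (X0 : E) (ell : nat -> nat -> I).

Fixpoint rcdlin_outer (k : nat) : E :=
  if k is k'.+1 then rcdlin_inner (rcdlin_outer k') (ell k') S else X0.

Definition rcdlin (k s : nat) : E := rcdlin_inner (rcdlin_outer k) (ell k) s.

Definition theta (k s : nat) : R :=
  frob (egrad f (rcdlin_outer k)) (B (ell k s) (rcdlin k s)).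

Definition fresh (k s : nat) : R :=
  frob (egrad f (rcdlin k s)) (B (ell k s) (rcdlin k s)).

Definition iterates_in (K : nat) (calX : set E) : Prop :=
  forall k s, (k < K)%N -> (s <= S)%N -> calX (rcdlin k s).

(* The two inequalities are void when [fresh k s = 0]. The last clause extends
   to that case what they give otherwise, |theta| <= w1 * |fresh|. Without it
   the cyclic rate fails: for f x = x ^+ 2 / 2 on the line, two basis vectors
   both equal to 1, S = 2 and eta = L = 1, the iterates of an epoch are
   x, 0, - x, so no progress is ever made. *)
Definition comparable_coefs (K Smax : nat) (w0 w1 : R) : Prop :=
  forall k s, (k < K)%N -> (s < S)%N -> (s <= Smax - 1)%N ->
    w0 * fresh k s ^+ 2 <= theta k s * fresh k s <= w1 * fresh k s ^+ 2 /\
    (fresh k s = 0 -> theta k s = 0).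

End RCDlin.
End Basis.
End Geometry.

Definition independent_choices (R : realType) (d : measure_display)
    (Om : measurableType d) (P : probability Om R) (I : finType) (K S : nat)
    (ell : nat -> nat -> Om -> I) : Prop :=
  forall (J : {set 'I_K * 'I_S}) (A : 'I_K * 'I_S -> {set I}),
    P [set w | forall j, j \in J -> ell j.1 j.2 w \in A j] =
    (\prod_(j in J) fine (P [set w | ell j.1 j.2 w \in A j]))%:E.

Definition uniform_choices (R : realType) (d : measure_display)
    (Om : measurableType d) (P : probability Om R) (I : finType) (K S : nat)
    (ell : nat -> nat -> Om -> I) : Prop :=
  forall k s, (k < K)%N -> (s < S)%N -> forall i,
    measurable [set w | ell k s w = i] /\
    P [set w | ell k s w = i] = (#|I|%:R^-1)%:E.

(* Main.v *)
Require Import Defs.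
From HB Require Import structures.
From mathcomp Require Import all_boot all_order all_algebra.
From mathcomp Require Import all_classical all_reals all_analysis.
From mathcomp Require Import measurable_realfun ring lra.

Set Implicit Arguments.
Unset Strict Implicit.
Unset Printing Implicit Defensive.

Import Order.TTheory GRing.Theory Num.Theory.
Import numFieldNormedType.Exports.

Local Open Scope classical_set_scope.
Local Open Scope ring_scope.

(** Put G = grad f.  One step from X along B_l moves by - eta theta B_l and the
    quadratic upper bound on f along the retraction, with
    theta ^ 2 <= w1 ^ 2 fresh ^ 2, w0 fresh ^ 2 <= theta fresh and the chosen
    eta, gives f(X) - f(X') >= gain * fresh ^ 2, where
    gain = w0 ^ 2 / (2 L cb w1 ^ 2) and fresh = <G(X), B_l>_X
    ([descent_step]).  Telescoping bounds gain times the sum of all fresh ^ 2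
    by f(X0) - fstar ([run_total_descent]).  What remains is to bound |G| ^ 2
    by such squares.

    Random selection.  There are finitely many sequences of choices, each of
    positive probability, so an almost sure hypothesis holds for every
    sequence ([path_of_ae_exists]) and expectations are plain averages over
    sequences ([expectation_path_of]).  The iterate (k, s) does not depend on
    the choice (k, s); replacing that choice by an arbitrary index therefore
    permutes the pairs (sequence, index), and the average of fresh ^ 2 is the
    average over l of <G, B_l> ^ 2 ([sum_resample]), which is at least
    cp / (cb #|I|) |G| ^ 2 ([sum_ip_B_lower]).

    Cyclic selection.  Every l is used once per epoch, but at an iterate X_s
    which differs from the anchor X_0, so G(X_0) and G(X_s) have to be compared
    along B_l.  The gradient is Lipschitz across one retraction step only, and
    transports need not compose, so the comparison cannot go through the
    transport from X_0 to X_s.  The lower bound on transported projections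
    repairs this: it says that the functional V |-> <T V, B_{l,X}>_X vanishes
    only where V |-> <V, B_{l,Y}>_Y does, hence the two are proportional, and by
    the isometry the coordinate of T V along the unit vector B_{l,X}/|B_{l,X}|
    is at most that of V along B_{l,Y}/|B_{l,Y}| in absolute value
    ([frame_coord_transport_le]).  Coordinates can then be followed step by
    step ([frame_coord_grad_chain]): the coordinate of G(X_0) is at most that of
    G(X_s) plus sqrt(Lg) times the sum of the step lengths, and the steps are
    themselves bounded by the fresh coefficients ([step_sqr_le]).  Summing over
    l bounds |G(X_0)| ^ 2 by the decrease of f over the epoch
    ([cyclic_epoch]). *)

(** * Inner products on a subspace *)

Section InnerProduct.
Variables (R : realType) (m n : nat).
Variables (T : set 'M[R]_(m, n)) (b : 'M[R]_(m, n) -> 'M[R]_(m, n) -> R).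
Hypothesis T_lin : forall (a : R) U V, T U -> T V -> T (a *: U + V).
Hypothesis b_ip : inner_product_on T b.

Lemma ip_sym U V : T U -> T V -> b U V = b V U.
Proof. by case: b_ip => bC _ _; apply: bC. Qed.

Lemma ip_linear (a : R) U V Z : T U -> T V -> T Z ->
  b (a *: U + V) Z = a * b U Z + b V Z.
Proof. by case: b_ip => _ bl _; apply: bl. Qed.

Lemma lin_closed0 U : T U -> T 0.
Proof. by move=> TU; have := T_lin (-1) TU TU; rewrite scaleN1r addNr. Qed.

Lemma ip0l U V : T U -> T V -> b 0 V = 0.
Proof.
move=> TU TV; have T0 := lin_closed0 TU.
have := ip_linear (-1) T0 T0 TV.
by rewrite scaler0 addr0 mulN1r addNr.
Qed.

Lemma lin_closedZ (a : R) U : T U -> T (a *: U).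
Proof.
by move=> TU; have := T_lin a TU (lin_closed0 TU); rewrite addr0.
Qed.

Lemma lin_closedB U V : T U -> T V -> T (U - V).
Proof. by move=> TU TV; rewrite addrC -scaleN1r; apply: T_lin. Qed.

Lemma ipZl (a : R) U V : T U -> T V -> b (a *: U) V = a * b U V.
Proof.
move=> TU TV; have := ip_linear a TU (lin_closed0 TU) TV.
by rewrite addr0 (ip0l TU TV) addr0.
Qed.

Lemma ipZr (a : R) U V : T U -> T V -> b U (a *: V) = a * b U V.
Proof.
by move=> TU TV; rewrite ip_sym ?ipZl// 1?ip_sym//; exact: lin_closedZ.
Qed.

Lemma ipBl U V Z : T U -> T V -> T Z -> b (U - V) Z = b U Z - b V Z.
Proof. by move=> TU TV TZ; rewrite addrC -scaleN1r ip_linear// mulN1r addrC. Qed.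

Lemma ip_ge0 U : T U -> 0 <= b U U.
Proof.
move=> TU; have [->|U0] := eqVneq U 0; first by rewrite (ip0l TU (lin_closed0 TU)).
by case: b_ip => _ _ bp; apply/ltW/bp.
Qed.

Lemma cauchy_schwarz U V : T U -> T V -> b U V ^+ 2 <= b U U * b V V.
Proof.
move=> TU TV; have [V0|V0] := eqVneq V 0.
  by rewrite ip_sym// V0 (ip0l TU TU) expr0n mulr_ge0// ip_ge0// -V0.
have bV : 0 < b V V by case: b_ip => _ _ bp; apply: bp.
set c := - (b U V / b V V).
have TW : T (c *: V + U) by apply: T_lin.
have := ip_ge0 TW.
rewrite ip_linear// (ip_sym TV TW) (ip_sym TU TW) !ip_linear// (ip_sym TV TU).
have -> : c * (c * b V V + b U V) + (c * b U V + b U U)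
  = (b U U * b V V - b U V ^+ 2) / b V V.
  by rewrite /c; field; exact: lt0r_neq0.
by rewrite pmulr_lge0 ?invr_gt0// subr_ge0.
Qed.

End InnerProduct.

(** * Transport of the frame and coordinates of the gradient *)

Section Geometry.
Variables (R : realType) (m n : nat) (M : set 'M[R]_(m, n)).
Variable g : 'M[R]_(m, n) -> 'M[R]_(m, n) -> 'M[R]_(m, n) -> R.
Variables (I : finType) (B : I -> 'M[R]_(m, n) -> 'M[R]_(m, n)).
Hypothesis g_ip : forall X, M X -> inner_product_on (tangent M X) (g X).
Hypothesis B_span : spanning_basis B M.

Lemma tangent_lin X (a : R) U V : M X ->
  tangent M X U -> tangent M X V -> tangent M X (a *: U + V).
Proof.
move=> MX; rewrite (B_span MX) => -[u _ <-] [v _ <-].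
exists (fun l => a * u l + v l) => //.
rewrite scaler_sumr -big_split; apply: eq_bigr => l _.
by rewrite scalerDl scalerA.
Qed.

Lemma tangentZ X (a : R) U : M X -> tangent M X U -> tangent M X (a *: U).
Proof.
by move=> MX; apply: lin_closedZ => b V W; exact: tangent_lin.
Qed.

Lemma tangent_B X l : M X -> tangent M X (B l X).
Proof.
move=> MX; rewrite (B_span MX); exists (fun i => (i == l)%:R) => //.
rewrite (bigD1 l)//= eqxx scale1r big1 ?addr0// => i /negPf->.
by rewrite scale0r.
Qed.

Lemma rnorm_sqr X U : M X -> tangent M X U -> rnorm g X U ^+ 2 = g X U U.
Proof.
move=> MX TU; rewrite sqr_sqrtr//.
by apply: (ip_ge0 _ (g_ip MX)) => // a V W; apply: tangent_lin.
Qed.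

Lemma rnorm_ge0 X U : 0 <= rnorm g X U.
Proof. exact: sqrtr_ge0. Qed.

Lemma rnormZ_sqr X (a : R) U : M X -> tangent M X U ->
  rnorm g X (a *: U) ^+ 2 = a ^+ 2 * rnorm g X U ^+ 2.
Proof.
move=> MX TU; have Tl a' V W := @tangent_lin X a' V W MX.
have TaU := lin_closedZ Tl a TU.
rewrite !rnorm_sqr//.
by rewrite (ipZl Tl (g_ip MX))// (ipZr Tl (g_ip MX))//; ring.
Qed.

Lemma rnorm_projB_sqr X l U : M X ->
  rnorm g X (projB B g l X U) ^+ 2
    = g X U (B l X) ^+ 2 * rnorm g X (B l X) ^+ 2.
Proof. by move=> MX; rewrite rnormZ_sqr//; apply: tangent_B. Qed.

Lemma ip_sqr_le X U V : M X -> tangent M X U -> tangent M X V ->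
  g X U V ^+ 2 <= rnorm g X U ^+ 2 * rnorm g X V ^+ 2.
Proof.
move=> MX TU TV; rewrite !rnorm_sqr//.
by apply: (cauchy_schwarz _ (g_ip MX)) => // a V' W; apply: tangent_lin.
Qed.

(** The coordinate along the unit vector of direction [B l X]; it is 0 when
    [B l X = 0].  Normalizing matters: a transport does not increase the absolute
    value of this number, while it may rescale [B l X]. *)
Definition frame_coord l X U := g X U (B l X) / rnorm g X (B l X).

Lemma frame_coord_le_rnorm X l U : M X -> tangent M X U ->
  `|frame_coord l X U| <= rnorm g X U.
Proof.
move=> MX TU; have TB := tangent_B l MX.
have [n0|n0] := eqVneq (rnorm g X (B l X)) 0.
  by rewrite /frame_coord n0 invr0 mulr0 normr0 rnorm_ge0.
have np : 0 < rnorm g X (B l X) by rewrite lt_neqAle eq_sym n0 rnorm_ge0.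
rewrite /frame_coord normrM normfV (gtr0_norm np) ler_pdivrMr//.
rewrite -(@ler_pXn2r _ 2) ?nnegrE ?mulr_ge0 ?rnorm_ge0 ?(ltW np)//.
by rewrite real_normK ?num_real// exprMn; apply: ip_sqr_le.
Qed.

Lemma frame_coordB X l U V : M X -> tangent M X U -> tangent M X V ->
  frame_coord l X (U - V) = frame_coord l X U - frame_coord l X V.
Proof.
move=> MX TU TV.
rewrite /frame_coord (ipBl (g_ip MX))// ?mulrBl//; exact: tangent_B.
Qed.

Lemma frame_coordE X l U : M X -> tangent M X U ->
  rnorm g X (B l X) ^+ 2 * frame_coord l X U ^+ 2 = g X U (B l X) ^+ 2.
Proof.
move=> MX TU; have [n0|n0] := eqVneq (rnorm g X (B l X)) 0; last first.
  by rewrite /frame_coord; field.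
have := ip_sqr_le MX TU (tangent_B l MX).
rewrite n0 expr0n mulr0 mul0r => h; apply/eqP.
by rewrite eq_sym eq_le h sqr_ge0.
Qed.

Variable calX : set 'M[R]_(m, n).
Hypothesis calXM : calX `<=` M.
Variable Tr : 'M[R]_(m, n) -> 'M[R]_(m, n) -> 'M[R]_(m, n) -> 'M[R]_(m, n).
Hypothesis Tr_isom : isometric_transport M calX g Tr.
Variable ups : R.
Hypothesis ups_gt0 : 0 < ups.
Hypothesis projB_transport : forall l X Y V, calX X -> calX Y ->
  tangent M Y V -> ups * rnorm g Y (projB B g l Y V) ^+ 2
    <= rnorm g X (projB B g l X (Tr Y X V)) ^+ 2.

Lemma ip_B_transport l X Y V : calX X -> calX Y -> tangent M Y V ->
  ups * (g Y V (B l Y) ^+ 2 * rnorm g Y (B l Y) ^+ 2)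
    <= g X (Tr Y X V) (B l X) ^+ 2 * rnorm g X (B l X) ^+ 2.
Proof.
move=> cX cY TV; have [MX MY] := (calXM cX, calXM cY).
by have := projB_transport l cX cY TV; rewrite !rnorm_projB_sqr.
Qed.

Lemma tangent_transport X Y V : calX X -> calX Y -> tangent M Y V ->
  tangent M X (Tr Y X V).
Proof. by move=> cX cY TV; have [+ _ _] := Tr_isom cY cX; apply. Qed.

Lemma transport_B_sqr_le l X Y : calX X -> calX Y ->
  g X (Tr Y X (B l Y)) (B l X) ^+ 2
    <= rnorm g Y (B l Y) ^+ 2 * rnorm g X (B l X) ^+ 2.
Proof.
move=> cX cY; have [MX MY] := (calXM cX, calXM cY).
have TBY := tangent_B l MY; have TTB := tangent_transport cX cY TBY.
have := ip_sqr_le MX TTB (tangent_B l MX).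
rewrite (rnorm_sqr MX TTB) (rnorm_sqr MY TBY).
by have [_ _ ->] := Tr_isom cY cX.
Qed.

(** The projection bound is applied to [B l Y] itself, where Cauchy-Schwarz
    and the isometry control the transported inner product. *)
Lemma rnorm_B_transport l X Y : calX X -> calX Y ->
  ups * rnorm g Y (B l Y) ^+ 4 <= rnorm g X (B l X) ^+ 4.
Proof.
move=> cX cY; have [MX MY] := (calXM cX, calXM cY).
have TBY := tangent_B l MY.
have [n0|n0] := eqVneq (rnorm g Y (B l Y)) 0.
  by rewrite n0 expr0n mulr0 exprn_even_ge0.
have np : 0 < rnorm g Y (B l Y) ^+ 2 by rewrite exprn_even_gt0.
rewrite -(ler_pM2r np).
have := ip_B_transport l cX cY TBY; rewrite -(rnorm_sqr MY TBY).
have := transport_B_sqr_le l cX cY.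
move: np; set a := rnorm g Y _ ; set c := rnorm g X _; set p := g _ _ _.
move=> np h1 h2.
have h3 : p ^+ 2 * c ^+ 2 <= (a ^+ 2 * c ^+ 2) * c ^+ 2.
  by rewrite ler_wpM2r// sqr_ge0.
have -> : ups * a ^+ 4 * a ^+ 2 = ups * ((a ^+ 2) ^+ 2 * a ^+ 2) by ring.
have -> : c ^+ 4 * a ^+ 2 = (a ^+ 2 * c ^+ 2) * c ^+ 2 by ring.
exact: le_trans h2 h3.
Qed.

(** With phi V = <T V, B_X>_X and psi V = <V, B_Y>_Y, the projection bound gives
    ker phi <= ker psi.  Both functionals are therefore proportional, with
    ratio phi(B_Y) / |B_Y| ^ 2, and |phi(B_Y)| <= |B_X| |B_Y|. *)
Lemma frame_coord_transport_le l X Y V : calX X -> calX Y -> tangent M Y V ->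
  `|frame_coord l X (Tr Y X V)| <= `|frame_coord l Y V|.
Proof.
move=> cX cY TV; have [MX MY] := (calXM cX, calXM cY).
have TBY := tangent_B l MY.
have TY a U W := @tangent_lin Y a U W MY.
have [nX0|nX0] := eqVneq (rnorm g X (B l X)) 0.
  by rewrite {1}/frame_coord nX0 invr0 mulr0 normr0 normr_ge0.
have nX : 0 < rnorm g X (B l X) by rewrite lt_neqAle eq_sym nX0 rnorm_ge0.
(* The reverse transport shows that [B l] vanishes at X if it does at Y. *)
have nY : 0 < rnorm g Y (B l Y).
  rewrite lt_neqAle eq_sym rnorm_ge0 andbT; apply/eqP => nY0.
  have := rnorm_B_transport l cY cX; rewrite nY0 expr0n.
  by apply/negP; rewrite -ltNge mulr_gt0// exprn_gt0.
have nY2 : 0 < rnorm g Y (B l Y) ^+ 2 by rewrite exprn_gt0.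
pose phi U := g X (Tr Y X U) (B l X).
pose psi U := g Y U (B l Y).
have phi_lin a U W : tangent M Y U -> tangent M Y W ->
    phi (a *: U + W) = a * phi U + phi W.
  move=> TU TW; rewrite /phi; have [TT -> // _] := Tr_isom cY cX.
  by rewrite (ip_linear (g_ip MX))//; [exact: TT|exact: TT|exact: tangent_B].
have ker U : tangent M Y U -> phi U = 0 -> psi U = 0.
  move=> TU pU; have := ip_B_transport l cX cY TU.
  rewrite -/(phi U) -/(psi U) pU expr0n mul0r => h.
  apply/eqP; rewrite -sqrf_eq0 eq_le sqr_ge0 andbT.
  by rewrite -(pmulr_rle0 _ ups_gt0) -(pmulr_lle0 _ nY2) -mulrA.
have psiB : psi (B l Y) = rnorm g Y (B l Y) ^+ 2 by rewrite rnorm_sqr.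
have phiB : phi (B l Y) != 0.
  by apply/eqP => /(ker _ TBY); rewrite psiB => h; rewrite h ltxx in nY2.
have phiV : phi V * psi (B l Y) = phi (B l Y) * psi V.
  have : psi (- (phi V / phi (B l Y)) *: B l Y + V) = 0.
    by apply: ker; [exact: TY|rewrite phi_lin//; field].
  rewrite /psi (ip_linear (g_ip MY))// -/(psi _) -/(psi _) => /eqP.
  by rewrite addrC mulNr subr_eq0 => /eqP ->; field.
rewrite -(@ler_pXn2r _ 2) ?nnegrE// !real_normK ?num_real//.
rewrite /frame_coord -/(phi V) -/(psi V) !expr_div_n.
rewrite ler_pdivrMr ?exprn_gt0// mulrAC ler_pdivlMr ?exprn_gt0//.
rewrite -(ler_pM2r nY2).
have -> : phi V ^+ 2 * rnorm g Y (B l Y) ^+ 2 * rnorm g Y (B l Y) ^+ 2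
    = phi (B l Y) ^+ 2 * psi V ^+ 2.
  by rewrite -[RHS]exprMn -phiV psiB; ring.
have -> : psi V ^+ 2 * rnorm g X (B l X) ^+ 2 * rnorm g Y (B l Y) ^+ 2
    = rnorm g Y (B l Y) ^+ 2 * rnorm g X (B l X) ^+ 2 * psi V ^+ 2 by ring.
by rewrite ler_wpM2r ?sqr_ge0//; exact: transport_B_sqr_le.
Qed.

Variables (Retr : 'M[R]_(m, n) -> 'M[R]_(m, n) -> 'M[R]_(m, n)).
Variables (grad : 'M[R]_(m, n) -> 'M[R]_(m, n)) (Lg : R).
Hypothesis Lg_gt0 : 0 < Lg.
Hypothesis tangent_grad : forall X, M X -> tangent M X (grad X).
Hypothesis grad_lip : forall X U, calX X -> tangent M X U ->
  calX (Retr X U) ->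
  rnorm g X (grad X - Tr (Retr X U) X (grad (Retr X U))) ^+ 2
    <= Lg * rnorm g X U ^+ 2.

Lemma frame_coord_grad_step l X U :
  calX X -> tangent M X U -> calX (Retr X U) ->
  `|frame_coord l X (grad X)|
    <= `|frame_coord l (Retr X U) (grad (Retr X U))|
       + Num.sqrt Lg * rnorm g X U.
Proof.
move=> cX TU cY; set Y := Retr X U; have [MX MY] := (calXM cX, calXM cY).
have TG := tangent_grad MX.
have TGY := tangent_transport cX cY (tangent_grad MY).
rewrite -(subrK (frame_coord l X (Tr Y X (grad Y))) (frame_coord l X (grad X))).
apply: le_trans (ler_normD _ _) _; rewrite addrC lerD//.
  exact/frame_coord_transport_le/tangent_grad.
rewrite -frame_coordB//; apply: le_trans (frame_coord_le_rnorm _ MX _) _.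
  by apply: lin_closedB => // a V W; exact: tangent_lin.
rewrite -(@ler_pXn2r _ 2) ?nnegrE ?mulr_ge0 ?rnorm_ge0 ?sqrtr_ge0//.
by rewrite exprMn (sqr_sqrtr (ltW Lg_gt0)); apply: grad_lip.
Qed.

(** Only consecutive iterates are compared, because nothing is known about the
    gradient across a composition of retractions. *)
Lemma frame_coord_grad_chain l (X_ U_ : nat -> 'M[R]_(m, n)) s :
  (forall i, (i <= s)%N -> calX (X_ i)) ->
  (forall i, (i < s)%N -> tangent M (X_ i) (U_ i)) ->
  (forall i, (i < s)%N -> X_ i.+1 = Retr (X_ i) (U_ i)) ->
  `|frame_coord l (X_ 0%N) (grad (X_ 0%N))|
  <= `|frame_coord l (X_ s) (grad (X_ s))|
     + Num.sqrt Lg * \sum_(i < s) rnorm g (X_ i) (U_ i).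
Proof.
elim: s => [|s IH] cX TU XE; first by rewrite big_ord0 mulr0 addr0.
apply: le_trans (IH _ _ _) _ => [i le_is|i lt_is|i lt_is|].
- exact: cX (leqW le_is).
- exact: TU (leqW lt_is).
- exact: XE (leqW lt_is).
rewrite big_ord_recr/= mulrDr addrCA addrC lerD2r XE//.
apply: frame_coord_grad_step; [exact: cX|exact: TU|rewrite -XE//; exact: cX].
Qed.

End Geometry.

(** * Elementary estimates *)

Lemma sqr_sum_le (R : realFieldType) (s : nat) (u : nat -> R) :
  (\sum_(i < s) u i) ^+ 2 <= s%:R * \sum_(i < s) u i ^+ 2.
Proof.
elim: s => [|s IH]; first by rewrite !big_ord0 expr0n mulr0.
rewrite !big_ord_recr/=; set a := \sum_(i < s) u i in IH *.
set q := \sum_(i < s) u i ^+ 2 in IH *.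
(* The cross terms of the square are absorbed by this sum of squares. *)
have : 0 <= \sum_(i < s) (u s - u i) ^+ 2.
  by apply: sumr_ge0 => i _; exact: sqr_ge0.
have -> : \sum_(i < s) (u s - u i) ^+ 2 = s%:R * u s ^+ 2 - 2 * u s * a + q.
  transitivity (\sum_(i < s) (u s ^+ 2 + - (2 * u s) * u i + u i ^+ 2)).
    by apply: eq_bigr => i _; ring.
  by rewrite !big_split/= sumr_const card_ord -mulr_sumr [s%:R * _]mulr_natl mulNr.
move=> h; rewrite -natr1; nra.
Qed.

Lemma exists_le_avg (R : realFieldType) (T : finType) (x : T -> R) (c : R) :
  (0 < #|T|)%N -> \sum_t x t <= c -> exists t, x t <= c / #|T|%:R.
Proof.
move=> T0 hx; apply: contrapT => /forallNP h.
have Tp : (0 : R) < #|T|%:R by rewrite ltr0n.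
have : \sum_(t : T) c / #|T|%:R < \sum_t x t.
  have /card_gt0P [t0 _] := T0.
  rewrite (bigD1 t0)//= [ltRHS](bigD1 t0)//=.
  have lt t : c / #|T|%:R < x t by rewrite ltNge; apply/negP/h.
  by apply: ltr_leD => //; apply: ler_sum => t _; exact: ltW.
rewrite sumr_const -[_ *+ _]mulr_natr divfK ?gt_eqF//.
by rewrite ltNge hx.
Qed.

Lemma theta_sqr_le (R : realFieldType) (w0 w1 fr th : R) : 0 <= w0 ->
  w0 * fr ^+ 2 <= th * fr <= w1 * fr ^+ 2 -> (fr = 0 -> th = 0) ->
  th ^+ 2 <= w1 ^+ 2 * fr ^+ 2.
Proof.
move=> w00 /andP[h0 h1] hz; have [fr0|fr0] := eqVneq fr 0.
  by rewrite (hz fr0) fr0 !expr0n mulr0.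
have frp : 0 < fr ^+ 2 by rewrite exprn_even_gt0.
have thfr : 0 <= th * fr by apply: le_trans h0; rewrite mulr_ge0// ltW.
rewrite -(ler_pM2r frp) -exprMn -mulrA -expr2 -exprMn.
by rewrite ler_pXn2r ?nnegrE//; apply: le_trans h1.
Qed.

(** * Resampling one choice *)

(** If [h c i] does not look at the value [c j], then exchanging that value
    with [i] is an involution on the pairs [(c, i)], which turns the free index
    [i] into [c j].  This is the conditional expectation given all choices
    other than [j], in counting form. *)
Lemma sum_resample (R : pzSemiRingType) (J I : finType) (j : J)
    (h : {ffun J -> I} -> I -> R) :
  (forall (c : {ffun J -> I}) i i',
    h [ffun t => if t == j then i else c t] i' = h c i') ->
  \sum_c \sum_i h c i = #|I|%:R * \sum_c h c (c j).
Proof.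
move=> h_upd.
pose upd (p : {ffun J -> I} * I) :=
  ([ffun t => if t == j then p.2 else p.1 t], p.1 j).
have updK : involutive upd.
  move=> [c i]; rewrite /upd /= ffunE eqxx; congr pair.
  by apply/ffunP => t; rewrite !ffunE; case: eqVneq => [->|].
rewrite pair_big/= (reindex_inj (inv_inj updK))/=.
under eq_bigr do rewrite h_upd.
rewrite -(pair_big xpredT xpredT (fun c _ => h c (c j)))/= mulr_sumr.
by apply: eq_bigr => c _; rewrite sumr_const mulr_natl.
Qed.

(** * Runs and finite sequences of choices *)

(** A run takes its choices from a function on all pairs of naturals; the pair
    [j0] only serves to fill in the positions outside the K by S grid. *)
Definition choices_of (I : finType) (K S : nat) (j0 : 'I_K * 'I_S)
    (c : {ffun 'I_K * 'I_S -> I}) (k s : nat) : I :=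
  c (insubd j0.1 k, insubd j0.2 s).

Lemma choices_ofE (I : finType) (K S : nat) (j0 : 'I_K * 'I_S)
    (c : {ffun 'I_K * 'I_S -> I}) k s (kK : (k < K)%N) (sS : (s < S)%N) :
  choices_of j0 c k s = c (Ordinal kK, Ordinal sS).
Proof.
rewrite /choices_of; congr (c (_, _)); apply: val_inj;
by rewrite val_insubd/= ?kK ?sS.
Qed.

Section RunExtensionality.
Variables (R : realType) (m n : nat) (I : finType).
Variables (B : I -> 'M[R]_(m, n) -> 'M[R]_(m, n)) (f : 'M[R]_(m, n) -> R).
Variables (Retr : 'M[R]_(m, n) -> 'M[R]_(m, n) -> 'M[R]_(m, n)) (eta : R).
Variables (S : nat) (X0 : 'M[R]_(m, n)).

Lemma eq_rcdlin_inner X (l l' : nat -> I) s :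
  (forall i, (i < s)%N -> l i = l' i) ->
  rcdlin_inner B f Retr eta X l s = rcdlin_inner B f Retr eta X l' s.
Proof.
elim: s => //= s IH E; rewrite IH ?E// => i lt_is.
exact/E/ltnW.
Qed.

Lemma eq_rcdlin (ell ell' : nat -> nat -> I) k s :
  (forall i t, (i < k)%N -> (t < S)%N -> ell i t = ell' i t) ->
  (forall t, (t < s)%N -> ell k t = ell' k t) ->
  rcdlin B f Retr eta S X0 ell k s = rcdlin B f Retr eta S X0 ell' k s.
Proof.
move=> Ek Es; rewrite /rcdlin.
suff -> : rcdlin_outer B f Retr eta S X0 ell k
    = rcdlin_outer B f Retr eta S X0 ell' k by exact: eq_rcdlin_inner.
elim: k Ek {Es} => //= k IH E.
rewrite IH => [|i t lt_ik lt_tS]; last by apply: E => //; exact: ltnW.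
by apply: eq_rcdlin_inner => t lt_tS; exact: E.
Qed.

Variables (K Smax : nat) (calX : set 'M[R]_(m, n)) (w0 w1 : R).
Variables (ell ell' : nat -> nat -> I).
Hypothesis ell_eq : forall k s, (k < K)%N -> (s < S)%N -> ell k s = ell' k s.

Lemma eq_run k s : (k < K)%N -> (s <= S)%N ->
  rcdlin B f Retr eta S X0 ell k s = rcdlin B f Retr eta S X0 ell' k s.
Proof.
move=> kK sS; apply: eq_rcdlin => [i t ik tS|t ts].
  by apply: ell_eq => //; exact: ltn_trans kK.
by apply: ell_eq => //; exact: leq_trans sS.
Qed.

Lemma eq_iterates_in : iterates_in B f Retr eta S X0 ell K calX ->
  iterates_in B f Retr eta S X0 ell' K calX.
Proof. by move=> H k s kK sS; rewrite -eq_run//; exact: H. Qed.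

Lemma eq_comparable_coefs :
  comparable_coefs B f Retr eta S X0 ell K Smax w0 w1 ->
  comparable_coefs B f Retr eta S X0 ell' K Smax w0 w1.
Proof.
move=> H k s kK sS sSmax; have := H k s kK sS sSmax.
rewrite /theta /fresh (eq_run kK (ltnW sS)) (ell_eq kK sS).
by have := eq_run kK (leq0n S); rewrite /rcdlin/= => ->.
Qed.

End RunExtensionality.

(** * Independent uniform choices *)

Section FiniteChoices.
Variables (R : realType) (d : measure_display) (Om : measurableType d).
Variables (P : probability Om R) (I : finType) (K S : nat).
Variable ell : nat -> nat -> Om -> I.
Hypothesis ell_unif : uniform_choices P K S ell.
Hypothesis ell_indep : independent_choices P K S ell.

Definition path_of w : {ffun 'I_K * 'I_S -> I} :=
  [ffun j : 'I_K * 'I_S => ell j.1 j.2 w].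

Lemma path_of_preimage c : [set w | path_of w = c]
  = [set w | forall j, j \in [set: 'I_K * 'I_S]%SET ->
       ell j.1 j.2 w \in [set c j]%SET].
Proof.
apply/seteqP; split=> w /=.
  by move=> <- j _; rewrite ffunE inE.
by move=> H; apply/ffunP => j; have := H j; rewrite !inE ffunE => /(_ isT)/eqP.
Qed.

Lemma measurable_path_of c : measurable [set w | path_of w = c].
Proof.
have -> : [set w | path_of w = c]
    = \bigcap_(j in [set: 'I_K * 'I_S]) [set w | ell j.1 j.2 w = c j].
  apply/seteqP; split=> w /=.
    by move=> <- j _ /=; rewrite ffunE.
  by move=> H; apply/ffunP => j; rewrite ffunE; exact: H.
apply: fin_bigcap_measurable; first exact: finite_finset.
by move=> j _; have [] := ell_unif (ltn_ord j.1) (ltn_ord j.2) (c j).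
Qed.

Lemma prob_path_of c :
  P [set w | path_of w = c] = (#|{ffun 'I_K * 'I_S -> I}|%:R^-1)%:E.
Proof.
rewrite path_of_preimage (ell_indep [set: _]%SET (fun j => [set c j]%SET)).
congr (_%:E).
under eq_bigr => j _.
  have -> : [set w | ell j.1 j.2 w \in [set c j]%SET]
      = [set w | ell j.1 j.2 w = c j].
    by apply/seteqP; split=> w /=; rewrite inE => /eqP.
  have [_ ->] := ell_unif (ltn_ord j.1) (ltn_ord j.2) (c j).
  rewrite /=; over.
by rewrite prodr_const cardsT card_ffun natrX exprVn.
Qed.

Lemma choices_nonempty : (0 < K)%N -> (0 < S)%N -> (0 < #|I|)%N.
Proof.
move=> K0 S0.
have [w _] : [set: Om] !=set0.
  apply/set0P/eqP => O0; have := probability_setT P.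
  by rewrite O0 measure0 => /eqP; rewrite eq_sym onee_eq0.
by apply/card_gt0P; exists (ell 0 0 w).
Qed.

(** A set of full measure meets every event of positive probability, and there
    is one such event for each sequence of choices. *)
Lemma path_of_ae_exists (Q : Om -> Prop) c :
  (0 < #|{ffun 'I_K * 'I_S -> I}|)%N ->
  {ae P, forall w, Q w} -> exists2 w, path_of w = c & Q w.
Proof.
move=> N0 [A [mA PA QA]]; apply: contrapT => H.
have : (P [set w | path_of w = c] <= P A)%E.
  apply: le_measure; rewrite ?inE//; first exact: measurable_path_of.
  by move=> w /= wc; apply: QA => Qw; apply: H; exists w.
by rewrite prob_path_of PA lee_fin leNgt invr_gt0 ltr0n N0.
Qed.

Lemma expectation_path_of (F : {ffun 'I_K * 'I_S -> I} -> R) :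
  (forall c, 0 <= F c) ->
  ('E_P[fun w => F (path_of w)]
   = (#|{ffun 'I_K * 'I_S -> I}|%:R^-1 * \sum_c F c)%:E)%E.
Proof.
move=> F0; rewrite unlock.
have FE w : (F (path_of w))%:E
    = (\sum_c (F c)%:E * (\1_[set w | path_of w = c] w)%:E)%E.
  rewrite (bigD1 (path_of w))//= indicE mem_set//= mule1 big1 ?adde0// => c cw.
  rewrite indicE memNset ?mule0//= => wc.
  by rewrite wc eqxx in cw.
under eq_integral do rewrite /= FE.
have mI c : measurable_fun [set: Om]
    (fun w => (\1_[set w | path_of w = c] w : R)%:E).
  by apply/measurable_EFinP; exact/measurable_indic/measurable_path_of.
rewrite ge0_integral_sum//; first last.
- by move=> c w _; rewrite -EFinM lee_fin mulr_ge0.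
- by move=> c; exact: measurable_funeM.
rewrite mulr_sumr -sumEFin; apply: eq_bigr => c _.
rewrite ge0_integralZl_EFin//.
rewrite integral_indic//; last exact: measurable_path_of.
rewrite setIT -[X in (_ * X)%E]/(P [set w | path_of w = c]).
by rewrite prob_path_of -EFinM mulrC.
Qed.

End FiniteChoices.

(** * Descent along a run *)

Section Run.
Variables (R : realType) (m n : nat) (M : set 'M[R]_(m, n)).
Variable g : 'M[R]_(m, n) -> 'M[R]_(m, n) -> 'M[R]_(m, n) -> R.
Variables (I : finType) (B : I -> 'M[R]_(m, n) -> 'M[R]_(m, n)).
Hypothesis g_ip : forall X, M X -> inner_product_on (tangent M X) (g X).
Hypothesis B_span : spanning_basis B M.
Variable calX : set 'M[R]_(m, n).
Hypothesis calXM : calX `<=` M.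
Variables (f : 'M[R]_(m, n) -> R) (grad : 'M[R]_(m, n) -> 'M[R]_(m, n)).
Hypothesis f_grad : is_rgrad M g f grad.
Variables (Retr : 'M[R]_(m, n) -> 'M[R]_(m, n) -> 'M[R]_(m, n)).
Variables (cb L w0 w1 : R).
Hypotheses (cb_gt0 : 0 < cb) (L_gt0 : 0 < L).
Hypotheses (w0_gt0 : 0 < w0) (w1_gt0 : 0 < w1).
Hypothesis B_bound : forall X l, calX X -> rnorm g X (B l X) ^+ 2 <= cb.
Hypothesis f_descent : forall X U, calX X -> tangent M X U ->
  calX (Retr X U) ->
  f (Retr X U) - f X - g X (grad X) U <= L / 2 * rnorm g X U ^+ 2.

Let eta := w0 / (L * cb * w1 ^+ 2).
Let gain := w0 ^+ 2 / (2 * L * cb * w1 ^+ 2).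

Lemma tangent_step X (a : R) l : M X -> tangent M X (a *: B l X).
Proof.
by move=> MX; apply: (tangentZ B_span) => //; exact: (tangent_B B_span).
Qed.

Lemma tangent_grad X : M X -> tangent M X (grad X).
Proof. by move=> MX; have [] := f_grad MX. Qed.

Lemma frob_egradE X l : M X ->
  frob (egrad f X) (B l X) = g X (grad X) (B l X).
Proof.
by move=> MX; have [_ ->] := f_grad MX; last exact: (tangent_B B_span).
Qed.

(** The step size maximizes w0 eta - L cb w1 ^ 2 eta ^ 2 / 2, the guaranteed
    decrease per unit of fresh ^ 2; [gain] is the maximum. *)
Lemma descent_step X l th : calX X ->
  let fr := frob (egrad f X) (B l X) in
  let Y := Retr X (- (eta * th) *: B l X) in
  calX Y -> w0 * fr ^+ 2 <= th * fr <= w1 * fr ^+ 2 ->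
  (fr = 0 -> th = 0) -> gain * fr ^+ 2 <= f X - f Y.
Proof.
move=> cX fr Y cY hth hz; have MX := calXM cX.
have := f_descent cX (tangent_step (- (eta * th)) l MX) cY.
rewrite -/Y (rnormZ_sqr g_ip B_span)//; last exact: (tangent_B B_span).
have [TG _] := f_grad MX.
have Tl b U V := @tangent_lin _ _ _ _ _ _ B_span X b U V MX.
rewrite (ipZr Tl (g_ip MX))//; last exact: (tangent_B B_span).
rewrite -frob_egradE// -/fr => hL.
have eta0 : 0 < eta by rewrite /eta divr_gt0 ?mulr_gt0 ?exprn_gt0.
have hth2 := theta_sqr_le (ltW w0_gt0) hth hz.
have hq : L / 2 * ((- (eta * th)) ^+ 2 * rnorm g X (B l X) ^+ 2)
    <= L / 2 * (eta ^+ 2 * (w1 ^+ 2 * fr ^+ 2) * cb).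
  apply: ler_wpM2l; first by rewrite divr_ge0 ?ltW.
  apply: ler_pM; rewrite ?sqr_ge0//; last exact: B_bound.
  by rewrite sqrrN exprMn ler_wpM2l ?sqr_ge0.
have hl : eta * (w0 * fr ^+ 2) <= eta * (th * fr).
  by rewrite ler_wpM2l ?(ltW eta0)//; case/andP: hth.
have -> : gain * fr ^+ 2 = eta * (w0 * fr ^+ 2)
    - L / 2 * (eta ^+ 2 * (w1 ^+ 2 * fr ^+ 2) * cb).
  rewrite /gain /eta; field.
  by rewrite !gt_eqF.
lra.
Qed.

Variables (S K Smax : nat) (X0 : 'M[R]_(m, n)) (fstar : R).
Hypothesis K_gt0 : (0 < K)%N.
Hypothesis S_gt0 : (0 < S)%N.
Hypothesis S_le : (S <= Smax)%N.
Hypothesis fstar_le : forall X, M X -> fstar <= f X.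

Section FixedChoices.
Variable ell : nat -> nat -> I.
Local Notation x_ := (rcdlin B f Retr eta S X0 ell).
Local Notation fr_ := (fresh B f Retr eta S X0 ell).
Local Notation th_ := (theta B f Retr eta S X0 ell).
Hypothesis run_in : iterates_in B f Retr eta S X0 ell K calX.
Hypothesis run_comparable :
  comparable_coefs B f Retr eta S X0 ell K Smax w0 w1.

Lemma run_coefs k s : (k < K)%N -> (s < S)%N ->
  w0 * fr_ k s ^+ 2 <= th_ k s * fr_ k s <= w1 * fr_ k s ^+ 2 /\
  (fr_ k s = 0 -> th_ k s = 0).
Proof.
move=> kK sS; apply: run_comparable => //.
by rewrite -ltnS subn1 prednK ?(leq_trans S_gt0)// (leq_trans sS).
Qed.

Lemma run_descent k s : (k < K)%N -> (s < S)%N ->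
  gain * fr_ k s ^+ 2 <= f (x_ k s) - f (x_ k s.+1).
Proof.
move=> kK sS; have [h hz] := run_coefs kK sS.
apply: descent_step h hz; first exact/run_in/ltnW.
exact: (run_in kK sS).
Qed.

Lemma epoch_descent k : (k < K)%N ->
  gain * \sum_(s < S) fr_ k s ^+ 2 <= f (x_ k 0%N) - f (x_ k.+1 0%N).
Proof.
move=> kK; rewrite mulr_sumr.
have -> : f (x_ k 0%N) - f (x_ k.+1 0%N)
    = \sum_(s < S) (f (x_ k s) - f (x_ k s.+1)).
  rewrite -(big_mkord xpredT (fun s => f (x_ k s) - f (x_ k s.+1))).
  rewrite -[LHS]opprB -(@telescope_sumr _ 0 S (fun s => f (x_ k s)))//.
  by rewrite -sumrN; apply: eq_bigr => s _; rewrite opprB.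
by apply: ler_sum => s _; exact: run_descent.
Qed.

Lemma sum_epoch_decrease :
  \sum_(k < K) (f (x_ k 0%N) - f (x_ k.+1 0%N)) <= f X0 - fstar.
Proof.
have -> : \sum_(k < K) (f (x_ k 0%N) - f (x_ k.+1 0%N))
    = f X0 - f (x_ K 0%N).
  rewrite -(big_mkord xpredT (fun k => f (x_ k 0%N) - f (x_ k.+1 0%N))).
  rewrite -[RHS]opprB -(@telescope_sumr _ 0 K (fun k => f (x_ k 0%N)))//.
  by rewrite -sumrN; apply: eq_bigr => s _; rewrite opprB.
rewrite lerD2l lerN2; apply/fstar_le/calXM.
have KE := prednK K_gt0.
rewrite -KE; apply: (run_in _ (leqnn S)).
by rewrite KE.
Qed.

Lemma run_total_descent :
  gain * \sum_(k < K) \sum_(s < S) fr_ k s ^+ 2 <= f X0 - fstar.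
Proof.
apply: le_trans sum_epoch_decrease; rewrite mulr_sumr.
by apply: ler_sum => k _; exact: epoch_descent.
Qed.

(** * Cyclic selection *)

Section Cyclic.
Variable Tr : 'M[R]_(m, n) -> 'M[R]_(m, n) -> 'M[R]_(m, n) -> 'M[R]_(m, n).
Hypothesis Tr_isom : isometric_transport M calX g Tr.
Variables (ups cp Lg rho : R).
Hypotheses (ups_gt0 : 0 < ups) (cp_gt0 : 0 < cp) (Lg_gt0 : 0 < Lg).
Hypothesis rho_gt0 : 0 < rho.
Hypothesis projB_transport : forall l X Y V, calX X -> calX Y ->
  tangent M Y V -> ups * rnorm g Y (projB B g l Y V) ^+ 2
    <= rnorm g X (projB B g l X (Tr Y X V)) ^+ 2.
Hypothesis grad_lip : forall X U, calX X -> tangent M X U ->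
  calX (Retr X U) ->
  rnorm g X (grad X - Tr (Retr X U) X (grad (Retr X U))) ^+ 2
    <= Lg * rnorm g X U ^+ 2.
Hypothesis rho_step : forall X U, calX X -> tangent M X U ->
  calX (Retr X U) -> rnorm g X U ^+ 2 <= rho * rnorm g X U ^+ 2.
Hypothesis projB_lower : forall X U, calX X -> tangent M X U ->
  cp * rnorm g X U ^+ 2 <= \sum_(i : I) rnorm g X (projB B g i X U) ^+ 2.
Variable num : 'I_#|I| -> I.
Hypothesis num_bij : bijective num.
Hypothesis S_card : S = #|I|.
Hypothesis ell_num : forall k (s : 'I_#|I|), ell k s = num s.

Local Notation u_ := (fun k s =>
  - (eta * th_ k s) *: B (ell k s) (x_ k s)).

(** By [rho_step] the factor [rho] is at least 1 unless the step is zero.  With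
    the chosen [eta] the squared step is at most
    w0 ^ 2 / (L ^ 2 cb w1 ^ 2) fresh ^ 2, and w0 fresh ^ 2 <= w1 fresh ^ 2
    removes the ratio of the two constants. *)
Lemma step_sqr_le k s : (k < K)%N -> (s < S)%N ->
  cb * rnorm g (x_ k s) (u_ k s) ^+ 2 <= rho * L ^- 2 * fr_ k s ^+ 2.
Proof.
move=> kK sS; have cX : calX (x_ k s) by exact/run_in/ltnW.
have MX := calXM cX.
have TU : tangent M (x_ k s) (u_ k s) by exact: tangent_step.
have := rho_step cX TU (run_in kK sS).
have [hth hz] := run_coefs kK sS.
have hth2 := theta_sqr_le (ltW w0_gt0) hth hz.
have hw : w0 * fr_ k s ^+ 2 <= w1 * fr_ k s ^+ 2.
  by case/andP: hth => h; exact: le_trans.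
have hw2 : w0 ^+ 2 * fr_ k s ^+ 2 <= w1 ^+ 2 * fr_ k s ^+ 2.
  rewrite [w0 ^+ 2]expr2 [w1 ^+ 2]expr2 -!mulrA.
  apply: le_trans (ler_wpM2l (ltW w0_gt0) hw) _.
  by rewrite mulrCA; apply: (ler_wpM2l (ltW w1_gt0) hw).
have hn : rnorm g (x_ k s) (u_ k s) ^+ 2
    <= eta ^+ 2 * (w1 ^+ 2 * fr_ k s ^+ 2) * cb.
  rewrite (rnormZ_sqr g_ip B_span)//; last exact: (tangent_B B_span).
  apply: ler_pM; rewrite ?sqr_ge0//; last exact: B_bound.
  by rewrite sqrrN exprMn ler_wpM2l ?sqr_ge0.
move=> hr; rewrite -mulrA.
apply: le_trans (ler_wpM2l (ltW cb_gt0) hr) _.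
rewrite mulrCA ler_wpM2l ?(ltW rho_gt0)//.
apply: le_trans (ler_wpM2l (ltW cb_gt0) hn) _.
have -> : cb * (eta ^+ 2 * (w1 ^+ 2 * fr_ k s ^+ 2) * cb)
    = (L ^- 2 / w1 ^+ 2) * (w0 ^+ 2 * fr_ k s ^+ 2).
  by rewrite /eta; field; rewrite !gt_eqF.
have -> : L ^- 2 * fr_ k s ^+ 2
    = (L ^- 2 / w1 ^+ 2) * (w1 ^+ 2 * fr_ k s ^+ 2).
  by field; rewrite !gt_eqF.
by apply: ler_wpM2l hw2; rewrite mulr_ge0// invr_ge0 exprn_ge0// ltW.
Qed.

(** The squared projection at the anchor is at most ups^-1 |B_{l,X_s}| ^ 4 times
    the squared coordinate of the gradient there.  That coordinate splits into the one at X_s,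
    which gives the fresh coefficient, and the accumulated step lengths, whose
    squared sum costs one factor S. *)
Lemma projB_anchor_le k s : (k < K)%N -> (s < S)%N ->
  ups * rnorm g (x_ k 0%N)
          (projB B g (ell k s) (x_ k 0%N) (grad (x_ k 0%N))) ^+ 2
  <= 2 * cb * fr_ k s ^+ 2
     + 2 * cb * Lg * (S%:R * (rho * L ^- 2 * \sum_(i < S) fr_ k i ^+ 2)).
Proof.
move=> kK sS; set l := ell k s.
have c0 : calX (x_ k 0%N) by exact: run_in.
have cs : calX (x_ k s) by exact/run_in/ltnW.
have [M0 Ms] := (calXM c0, calXM cs).
have [TG0 TGs] := (tangent_grad M0, tangent_grad Ms).
rewrite (rnorm_projB_sqr g_ip B_span)// -(frame_coordE g_ip B_span l M0 TG0).
have hn := rnorm_B_transport g_ip B_span calXM Tr_isom projB_transport l cs c0.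
have hc : `|frame_coord g B l (x_ k 0%N) (grad (x_ k 0%N))|
    <= `|frame_coord g B l (x_ k s) (grad (x_ k s))|
      + Num.sqrt Lg * \sum_(i < s) rnorm g (x_ k i) (u_ k i).
  have H := frame_coord_grad_chain g_ip B_span calXM Tr_isom ups_gt0
    projB_transport Lg_gt0 tangent_grad grad_lip l.
  have {}H := H (x_ k) (fun i => - (eta * th_ k i) *: B (ell k i) (x_ k i)) s.
  apply: H => // i lt_is.
  - by apply: run_in => //; exact: leq_trans lt_is (ltnW sS).
  - apply: tangent_step; apply/calXM/run_in => //.
    exact: leq_trans (ltnW lt_is) (ltnW sS).
have hfr : rnorm g (x_ k s) (B l (x_ k s)) ^+ 2
    * frame_coord g B l (x_ k s) (grad (x_ k s)) ^+ 2 = fr_ k s ^+ 2.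
  by rewrite (frame_coordE g_ip B_span)// -frob_egradE.
have hb := B_bound l cs.
have hu : cb * (\sum_(i < s) rnorm g (x_ k i) (u_ k i)) ^+ 2
    <= S%:R * (rho * L ^- 2 * \sum_(i < S) fr_ k i ^+ 2).
  apply: le_trans
    (ler_wpM2l (ltW cb_gt0) (sqr_sum_le s (fun i => rnorm g (x_ k i) (u_ k i)))) _.
  rewrite mulrCA; apply: ler_pM; rewrite ?ler0n//.
  - by rewrite mulr_ge0 ?(ltW cb_gt0)// sumr_ge0// => i _; exact: sqr_ge0.
  - by rewrite ler_nat ltnW.
  rewrite !mulr_sumr (big_ord_widen S
    (fun i => cb * rnorm g (x_ k i) (u_ k i) ^+ 2) (ltnW sS)) big_mkcond/=.
  apply: ler_sum => i _; case: ifP => _; first exact: step_sqr_le.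
  by rewrite mulr_ge0 ?sqr_ge0// mulr_ge0 ?invr_ge0 ?sqr_ge0// ltW.
move: hn hc hfr hb hu.
set a := rnorm g (x_ k 0%N) _; set c := rnorm g (x_ k s) _.
set q := frame_coord _ _ _ (x_ k 0%N) _; set p := frame_coord _ _ _ (x_ k s) _.
set U := \sum_(i < s) _; set Z := S%:R * _ => hn hc hfr hb hu.
have hq : q ^+ 2 <= 2 * p ^+ 2 + 2 * (Lg * U ^+ 2).
  rewrite -[q ^+ 2]real_normK ?num_real// -[p ^+ 2]real_normK ?num_real//.
  have h2 : `|q| ^+ 2 <= (`|p| + Num.sqrt Lg * U) ^+ 2.
    by rewrite ler_pXn2r ?nnegrE// (le_trans _ hc).
  rewrite -(sqr_sqrtr (ltW Lg_gt0)).
  have := sqr_ge0 (`|p| - Num.sqrt Lg * U).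
  by move: h2; rewrite !expr2; lra.
have -> : ups * (a ^+ 2 * q ^+ 2 * a ^+ 2) = (ups * a ^+ 4) * q ^+ 2 by ring.
apply: le_trans (ler_pM _ (sqr_ge0 q) hn hq) _.
  by rewrite mulr_ge0 ?(ltW ups_gt0)// exprn_even_ge0.
have -> : c ^+ 4 * (2 * p ^+ 2 + 2 * (Lg * U ^+ 2))
  = 2 * (c ^+ 2 * (c ^+ 2 * p ^+ 2))
    + 2 * Lg * (c ^+ 2 * (c ^+ 2 * U ^+ 2)) by ring.
rewrite hfr.
apply: lerD.
  by rewrite -mulrA ler_wpM2l// ler_wpM2r// sqr_ge0.
have -> : 2 * cb * Lg * Z = 2 * Lg * (cb * Z) by ring.
apply: ler_wpM2l; first by rewrite mulr_ge0// ltW.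
apply: ler_pM => //; [exact: sqr_ge0|apply: mulr_ge0; exact: sqr_ge0|].
by apply: le_trans hu; rewrite ler_wpM2r ?sqr_ge0.
Qed.

(** Summing [projB_anchor_le] over the S = #|I| indices costs the second factor
    #|I| in front of the gradient variation. *)
Lemma cyclic_epoch k : (k < K)%N ->
  rnorm g (x_ k 0%N) (grad (x_ k 0%N)) ^+ 2
  <= 4 * L * cb ^+ 2 * w1 ^+ 2 * w0 ^- 2 * cp^-1 * ups^-1
     * (1 + #|I|%:R ^+ 2 * L ^- 2 * Lg * rho)
     * (f (x_ k 0%N) - f (x_ k.+1 0%N)).
Proof.
move=> kK; have c0 : calX (x_ k 0%N) by exact: run_in.
have TG0 := tangent_grad (calXM c0).
set F := \sum_(s < S) fr_ k s ^+ 2.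
set Z := 2 * cb * Lg * (S%:R * (rho * L ^- 2 * F)).
have h1 : ups * (cp * rnorm g (x_ k 0%N) (grad (x_ k 0%N)) ^+ 2)
    <= 2 * cb * F + S%:R * Z.
  apply: le_trans (ler_wpM2l (ltW ups_gt0) (projB_lower c0 TG0)) _.
  rewrite (reindex (num \o cast_ord S_card))/=; last first.
    apply: onW_bij; apply: (bij_comp num_bij).
    by exists (cast_ord (esym S_card)); [exact: cast_ordK|exact: cast_ordKV].
  rewrite mulr_sumr {1}/F mulr_sumr.
  have -> : S%:R * Z = \sum_(s < S) Z by rewrite sumr_const card_ord mulr_natl.
  rewrite -big_split/=; apply: ler_sum => s _.
  rewrite -(ell_num k) /Z /F.
  exact: (projB_anchor_le kK (ltn_ord s)).
have h2 := epoch_descent kK; rewrite -/F in h2.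
set N := rnorm _ _ _ ^+ 2 in h1 *; set D := f _ - f _ in h2 *.
have G0 : 0 < gain by rewrite divr_gt0 ?mulr_gt0 ?exprn_gt0.
set c := 1 + #|I|%:R ^+ 2 * L ^- 2 * Lg * rho.
have c_ge0 : 0 <= c.
  rewrite addr_ge0// mulr_ge0 ?(ltW rho_gt0)// mulr_ge0 ?(ltW Lg_gt0)//.
  by rewrite mulr_ge0 ?sqr_ge0// invr_ge0 sqr_ge0.
have -> : 4 * L * cb ^+ 2 * w1 ^+ 2 * w0 ^- 2 * cp^-1 * ups^-1 * c * D
    = 2 * cb * c / (ups * cp * gain) * D.
  by rewrite /gain; field; rewrite !gt_eqF.
rewrite mulrAC ler_pdivlMr; last by rewrite mulr_gt0// mulr_gt0.
have -> : N * (ups * cp * gain) = gain * (ups * (cp * N)) by ring.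
apply: le_trans (ler_wpM2l (ltW G0) h1) _.
have -> : gain * (2 * cb * F + S%:R * Z) = 2 * cb * c * (gain * F).
  by rewrite /Z /c S_card; ring.
by apply: ler_wpM2l h2; rewrite !mulr_ge0// ltW.
Qed.

Lemma cyclic_rate : exists k : 'I_K,
  rnorm g (x_ k 0%N) (grad (x_ k 0%N)) ^+ 2
  <= 4 * L * cb ^+ 2 * w1 ^+ 2 * w0 ^- 2 * cp^-1 * ups^-1
     * (1 + #|I|%:R ^+ 2 * L ^- 2 * Lg * rho) * (f X0 - fstar) / K%:R.
Proof.
rewrite -[X in _ / X%:R](card_ord K).
apply: exists_le_avg; first by rewrite card_ord.
apply: le_trans (ler_sum _ (fun k _ => cyclic_epoch (ltn_ord k))) _.
rewrite -mulr_sumr; apply: ler_wpM2l sum_epoch_decrease.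
rewrite mulr_ge0//.
  rewrite mulr_ge0 ?invr_ge0 ?(ltW ups_gt0)//.
  rewrite mulr_ge0 ?invr_ge0 ?(ltW cp_gt0)//.
  rewrite mulr_ge0 ?invr_ge0 ?sqr_ge0// mulr_ge0 ?sqr_ge0//.
  by rewrite mulr_ge0 ?sqr_ge0// mulr_ge0 ?(ltW L_gt0).
rewrite addr_ge0// mulr_ge0 ?(ltW rho_gt0)// mulr_ge0 ?(ltW Lg_gt0)//.
by rewrite mulr_ge0 ?sqr_ge0// invr_ge0 sqr_ge0.
Qed.

End Cyclic.
End FixedChoices.

(** * Random selection *)

Section Random.
Variable cp : R.
Hypothesis cp_gt0 : 0 < cp.
Hypothesis projB_lower : forall X U, calX X -> tangent M X U ->
  cp * rnorm g X U ^+ 2 <= \sum_(i : I) rnorm g X (projB B g i X U) ^+ 2.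

Variable j0 : 'I_K * 'I_S.
Local Notation x_ := (fun c => rcdlin B f Retr eta S X0 (choices_of j0 c)).
Local Notation fr_ := (fun c => fresh B f Retr eta S X0 (choices_of j0 c)).

Hypothesis paths_in : forall c,
  iterates_in B f Retr eta S X0 (choices_of j0 c) K calX.
Hypothesis paths_comparable : forall c,
  comparable_coefs B f Retr eta S X0 (choices_of j0 c) K Smax w0 w1.

Lemma sum_ip_B_lower X : calX X ->
  cp / cb * rnorm g X (grad X) ^+ 2 <= \sum_i g X (grad X) (B i X) ^+ 2.
Proof.
move=> cX; have MX := calXM cX; have TG := tangent_grad MX.
rewrite mulrAC ler_pdivrMr//; apply: le_trans (projB_lower cX TG) _.
rewrite mulr_suml; apply: ler_sum => i _.
by rewrite (rnorm_projB_sqr g_ip B_span)// ler_wpM2l ?sqr_ge0// B_bound.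
Qed.

(** Changing the choice made at position (k, s) leaves the iterate at (k, s)
    unchanged, which is what resampling needs. *)
Lemma sum_fresh_lower k s : (k < K)%N -> (s < S)%N ->
  cp / cb * \sum_c rnorm g (x_ c k s) (grad (x_ c k s)) ^+ 2
    <= #|I|%:R * \sum_c fr_ c k s ^+ 2.
Proof.
move=> kK sS; pose j : 'I_K * 'I_S := (Ordinal kK, Ordinal sS).
have cj c : choices_of j0 c k s = c j by rewrite (choices_ofE j0 c kK sS).
pose h c i := g (x_ c k s) (grad (x_ c k s)) (B i (x_ c k s)) ^+ 2.
have frE c : fr_ c k s ^+ 2 = h c (c j).
  rewrite /h -cj /fresh frob_egradE//.
  exact/calXM/paths_in/ltnW.
under [X in _ <= _ * X]eq_bigr do rewrite frE.
rewrite -(@sum_resample _ _ _ j h) => [|c i i'].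
  rewrite mulr_sumr; apply: ler_sum => c _.
  exact/sum_ip_B_lower/paths_in/ltnW.
have E : x_ [ffun t => if t == j then i else c t] k s = x_ c k s.
  have upd a b (aK : (a < K)%N) (bS : (b < S)%N) : (a != k) || (b != s) ->
      choices_of j0 [ffun t => if t == j then i else c t] a b
        = choices_of j0 c a b.
    move=> ne; rewrite !(choices_ofE j0 _ aK bS) ffunE.
    case: eqP => // -[ea eb].
    by rewrite ea eb !eqxx in ne.
  apply: eq_rcdlin => [a b ak bS|b bs].
    by apply: upd; rewrite ?(ltn_trans ak kK)// ltn_eqF.
  by apply: upd; rewrite ?(ltn_trans bs sS)// (ltn_eqF bs) orbT.
by rewrite /h E.
Qed.

Lemma random_rate : (0 < #|I|)%N -> exists (k : 'I_K) (s : 'I_S),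
  #|{ffun 'I_K * 'I_S -> I}|%:R^-1
    * \sum_c rnorm g (x_ c k s) (grad (x_ c k s)) ^+ 2
  <= 2 * L * cb ^+ 2 * cp^-1 * w0 ^- 2 * w1 ^+ 2 * #|I|%:R
       * (f X0 - fstar) / (K * S)%:R.
Proof.
move=> I0; set D := f X0 - fstar.
have N0 : (0 : R) < #|{ffun 'I_K * 'I_S -> I}|%:R.
  by rewrite ltr0n card_ffun expn_gt0 I0.
set N := #|{ffun 'I_K * 'I_S -> I}|%:R in N0 *.
have G0 : 0 < gain by rewrite divr_gt0 ?mulr_gt0 ?exprn_gt0.
have Ip : (0 : R) < #|I|%:R by rewrite ltr0n.
have h1 : gain * \sum_(k < K) \sum_(s < S) \sum_c fr_ c k s ^+ 2 <= N * D.
  have -> : \sum_(k < K) \sum_(s < S) \sum_c fr_ c k s ^+ 2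
      = \sum_c \sum_(k < K) \sum_(s < S) fr_ c k s ^+ 2.
    under eq_bigr do rewrite exchange_big.
    by rewrite exchange_big.
  have -> : N * D = \sum_(c : {ffun 'I_K * 'I_S -> I}) D.
    by rewrite sumr_const mulr_natl.
  rewrite mulr_sumr; apply: ler_sum => c _.
  exact: run_total_descent (paths_in c) (paths_comparable c).
have h2 : cp / cb * \sum_(k < K) \sum_(s < S)
      \sum_c rnorm g (x_ c k s) (grad (x_ c k s)) ^+ 2
    <= #|I|%:R * \sum_(k < K) \sum_(s < S) \sum_c fr_ c k s ^+ 2.
  rewrite !mulr_sumr; apply: ler_sum => k _.
  rewrite !mulr_sumr; apply: ler_sum => s _.
  exact: sum_fresh_lower.
set E := \sum_(k < K) _ in h2; set F := \sum_(k < K) _ in h1 h2.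
have h3 : N^-1 * E <= 2 * L * cb ^+ 2 * cp^-1 * w0 ^- 2 * w1 ^+ 2 * #|I|%:R * D.
  have -> : 2 * L * cb ^+ 2 * cp^-1 * w0 ^- 2 * w1 ^+ 2 * #|I|%:R * D
      = N^-1 * (cb / cp * (#|I|%:R * (gain^-1 * (N * D)))).
    by rewrite /gain; field; rewrite !gt_eqF.
  rewrite ler_wpM2l ?invr_ge0 ?(ltW N0)//.
  have -> : E = cb / cp * (cp / cb * E) by field; rewrite !gt_eqF.
  rewrite ler_wpM2l ?divr_ge0 ?(ltW cb_gt0) ?(ltW cp_gt0)//.
  apply: le_trans h2 _; rewrite ler_wpM2l ?(ltW Ip)//.
  by rewrite -[F](mulKf (lt0r_neq0 G0)) ler_wpM2l ?invr_ge0 ?(ltW G0).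
have /(@exists_le_avg _ ('I_K * 'I_S)%type) : 
  \sum_(p : 'I_K * 'I_S) (N^-1 * \sum_c
    rnorm g (x_ c p.1 p.2) (grad (x_ c p.1 p.2)) ^+ 2)
  <= 2 * L * cb ^+ 2 * cp^-1 * w0 ^- 2 * w1 ^+ 2 * #|I|%:R * D.
  rewrite -mulr_sumr -(pair_big xpredT xpredT (fun (k : 'I_K) (s : 'I_S) =>
    \sum_c     rnorm g (x_ c k s) (grad (x_ c k s)) ^+ 2))/=.
  exact: h3.
rewrite card_prod !card_ord muln_gt0 K_gt0 S_gt0 => /(_ isT)[[k s] H].
by exists k, s.
Qed.

End Random.

End Run.

(** * Convergence rates *)

Theorem theorem4p3 (R : realType) (m n d : nat) (M : set 'M[R]_(m, n))
  (g : 'M[R]_(m, n) -> 'M[R]_(m, n) -> 'M[R]_(m, n) -> R)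
  (f : 'M[R]_(m, n) -> R) (grad : 'M[R]_(m, n) -> 'M[R]_(m, n))
  (Retr : 'M[R]_(m, n) -> 'M[R]_(m, n) -> 'M[R]_(m, n))
  (Tr : 'M[R]_(m, n) -> 'M[R]_(m, n) -> 'M[R]_(m, n) -> 'M[R]_(m, n))
  (I : finType) (B : I -> 'M[R]_(m, n) -> 'M[R]_(m, n))
  (calX : set 'M[R]_(m, n)) (X0 : 'M[R]_(m, n)) (fstar : R)
  (cb cp L vth0 vth1 Lg ups w0 w1 : R) (K Smax S : nat)
  (hM : embedded_submanifold d M)
  (hg : riemannian_metric M g)
  (hf : forall X, M X -> differentiable f X)
  (hgrad : is_rgrad M g f grad)
  (hfstar : minimum_on M f fstar)
  (hRetr : retraction M Retr)
  (hTr : isometric_transport M calX g Tr)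
  (hB : spanning_basis B M)
  (hcalX : compact_nbhs_of_critical M calX grad)
  (hX0 : M X0)
  (hcb : 0 < cb) (hcp : 0 < cp) (hL : 0 < L) (hvth0 : 0 < vth0)
  (hvth1 : 0 < vth1) (hLg : 0 < Lg) (hups : 0 < ups)
  (hw0 : 0 < w0) (hw1 : 0 < w1)
  (hK : (1 <= K)%N) (hSmax : (0 < Smax)%N) (hS : (0 < S)%N)
  (A1 : forall X U l, calX X -> tangent M X U ->
     rnorm g X (B l X) ^+ 2 <= cb /\
     cp * rnorm g X U ^+ 2 <= \sum_(i : I) rnorm g X (projB B g i X U) ^+ 2)
  (A2 : forall X U, calX X -> tangent M X U -> calX (Retr X U) ->
     f (Retr X U) - f X - g X (grad X) U <= L / 2 * rnorm g X U ^+ 2)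
  (B1 : forall X U, calX X -> tangent M X U -> calX (Retr X U) ->
     ((vth0 * rnorm g X U ^+ 2)%:E <= rdist M g X (Retr X U) ^+ 2 /\
      rdist M g X (Retr X U) ^+ 2 <= (vth1 * rnorm g X U ^+ 2)%:E)%E)
  (B2 : forall X U, calX X -> tangent M X U -> calX (Retr X U) ->
     rnorm g X (grad X - Tr (Retr X U) X (grad (Retr X U))) ^+ 2
       <= Lg * rnorm g X U ^+ 2)
  (B3 : forall l X Y V, calX X -> calX Y -> tangent M Y V ->
     ups * rnorm g Y (projB B g l Y V) ^+ 2
       <= rnorm g X (projB B g l X (Tr Y X V)) ^+ 2) :
  (forall (disp : measure_display) (Om : measurableType disp)
     (P : probability Om R) (ell : nat -> nat -> Om -> I),
     (1 < S)%N -> (S <= Smax)%N ->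
     uniform_choices P K S ell -> independent_choices P K S ell ->
     let eta := w0 / (L * cb * w1 ^+ 2) in
     let run := fun w k s =>
       rcdlin B f Retr eta S X0 (fun i j => ell i j w) k s in
     {ae P, forall w,
        iterates_in B f Retr eta S X0 (fun i j => ell i j w) K calX /\
        comparable_coefs B f Retr eta S X0 (fun i j => ell i j w)
          K Smax w0 w1} ->
     (\big[Order.min/+oo]_(k < K) \big[Order.min/+oo]_(s < S)
        'E_P[fun w => (rnorm g (run w k s) (grad (run w k s)) ^+ 2)%R]
      <= (2 * L * cb ^+ 2 * cp^-1 * w0 ^- 2 * w1 ^+ 2 * #|I|%:R
          * (f X0 - fstar) / (K * S)%:R)%:E)%E)
  /\
  (forall (num : 'I_#|I| -> I) (ell : nat -> nat -> I),
     (#|I| <= Smax)%N -> S = #|I| ->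
     bijective num -> (forall k (s : 'I_#|I|), ell k s = num s) ->
     let eta := w0 / (L * cb * w1 ^+ 2) in
     let anchor := rcdlin_outer B f Retr eta S X0 ell in
     iterates_in B f Retr eta S X0 ell K calX ->
     comparable_coefs B f Retr eta S X0 ell K Smax w0 w1 ->
     (* [Order.max 1 cb^-1] is cb^-1 when cb <= 1. With cb^-1 alone the bound is
        false for large cb: the run is unchanged when every basis vector is
        multiplied by a constant, whereas the term in cb^-1 then vanishes. *)
     let C := 4 * L * cb ^+ 2 * w1 ^+ 2 * w0 ^- 2 * cp^-1 * ups^-1
       * (1 + #|I|%:R ^+ 2 * Order.max 1 cb^-1 * L ^- 2 * Lg
              * vth1 * vth0^-1) in
     \big[Order.min/rnorm g (anchor 0%N) (grad (anchor 0%N)) ^+ 2]_(k < K)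
        rnorm g (anchor k) (grad (anchor k)) ^+ 2
     <= C * (f X0 - fstar) / K%:R).
Proof.
have calXM : calX `<=` M by case: hcalX.
have [g_ip _] := hg; have [_ fstar_le] := hfstar.
have TG X : M X -> tangent M X (grad X) by move=> MX; have [] := hgrad X MX.
have B_bound X l : calX X -> rnorm g X (B l X) ^+ 2 <= cb.
  by move=> cX; have [] := A1 X _ l cX (TG X (calXM X cX)).
have projB_lower : (0 < #|I|)%N -> forall X U, calX X -> tangent M X U ->
    cp * rnorm g X U ^+ 2 <= \sum_(i : I) rnorm g X (projB B g i X U) ^+ 2.
  by move=> /card_gt0P[l _] X U cX TU; have [] := A1 X U l cX TU.
have D0 : 0 <= f X0 - fstar by rewrite subr_ge0 fstar_le.
split=> [disp Om P ell S1 SSmax unif indep eta run run_ae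
        |num ell ISmax SI num_bij ell_num eta anchor run_in run_cmp].
  have I0 := choices_nonempty P ell hK hS.
  pose j0 : 'I_K * 'I_S := (Ordinal hK, Ordinal hS).
  have pathE w k s : (k < K)%N -> (s < S)%N ->
      ell k s w = choices_of j0 (path_of K S ell w) k s.
    by move=> kK sS; rewrite (choices_ofE j0 _ kK sS) ffunE.
  (* The almost sure hypothesis on the run holds for every sequence. *)
  have paths_ok c : iterates_in B f Retr eta S X0 (choices_of j0 c) K calX /\
      comparable_coefs B f Retr eta S X0 (choices_of j0 c) K Smax w0 w1.
    have N0 : (0 < #|{ffun 'I_K * 'I_S -> I}|)%N.
      by rewrite card_ffun expn_gt0 I0.
    have [w <- [Hin Hcmp]] := path_of_ae_exists unif indep c N0 run_ae.
    split; first exact: eq_iterates_in (pathE w) Hin.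
    exact: eq_comparable_coefs (pathE w) Hcmp.
  have [k [s H]] := random_rate g_ip hB calXM hgrad hcb hL hw0 hw1 B_bound A2
    hK hS SSmax fstar_le hcp (projB_lower I0)
    (fun c => (paths_ok c).1) (fun c => (paths_ok c).2) I0.
  apply: (@bigmin_inf _ _ _ _ k) => //; apply: (@bigmin_inf _ _ _ _ s) => //.
  pose F c := rnorm g (rcdlin B f Retr eta S X0 (choices_of j0 c) k s)
    (grad (rcdlin B f Retr eta S X0 (choices_of j0 c) k s)) ^+ 2.
  have -> : (fun w => rnorm g (run w k s) (grad (run w k s)) ^+ 2)
      = (fun w => F (path_of K S ell w)).
    apply/funext => w; rewrite /run /F.
    by rewrite (eq_run B f Retr eta X0 (pathE w) (ltn_ord k) (ltnW (ltn_ord s))).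
  rewrite (expectation_path_of unif indep (F := F)) => [|c]; last exact: sqr_ge0.
  by rewrite lee_fin.
cbv zeta.
have I0 : (0 < #|I|)%N by rewrite -SI.
have rho0 : 0 < vth1 / vth0 by rewrite divr_gt0.
(* The two distance bounds together give vth0 <= vth1 for nonzero steps. *)
have rho_step X U : calX X -> tangent M X U -> calX (Retr X U) ->
    rnorm g X U ^+ 2 <= vth1 / vth0 * rnorm g X U ^+ 2.
  move=> cX TU cY; have [lo hi] := B1 X U cX TU cY.
  have := le_trans lo hi; rewrite lee_fin => h.
  by rewrite mulrAC ler_pdivlMr// mulrC.
have SSmax : (S <= Smax)%N by rewrite SI.
have [k H] := cyclic_rate g_ip hB calXM hgrad hcb hL hw0 hw1 B_bound A2
  hK hS SSmax fstar_le run_in run_cmp hTr hups hcp hLg rho0 B3 B2 rho_step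
  (projB_lower I0) num_bij SI ell_num.
apply: (@bigmin_inf _ _ _ _ k) => //; apply: le_trans H _.
rewrite ler_wpM2r ?invr_ge0 ?ler0n// ler_wpM2r//.
rewrite ler_wpM2l//.
  rewrite mulr_ge0 ?invr_ge0 ?(ltW hups)// mulr_ge0 ?invr_ge0 ?(ltW hcp)//.
  rewrite mulr_ge0 ?invr_ge0 ?sqr_ge0// mulr_ge0 ?sqr_ge0//.
  by rewrite mulr_ge0 ?sqr_ge0// mulr_ge0 ?(ltW hL).
rewrite lerD2l -[leRHS]mulrA -/(vth1 / vth0) ler_wpM2r ?(ltW rho0)//.
rewrite ler_wpM2r ?(ltW hLg)// ler_wpM2r ?invr_ge0 ?sqr_ge0//.
by rewrite ler_peMr ?sqr_ge0// le_max lexx.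
Qed.
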